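(* Let $G:\Sigma^{\mathbb{Z}}\to\Sigma^{\mathbb{Z}}$ be a reversible cellular automaton over a finite alphabet $\Sigma$, with block neighborhood $\mathcal{BN}\subseteq\mathbb{Z}$. For each cell $i\in\mathbb{Z}$ let $K_i=(G^{-1}\times\mathrm{id})\circ S_i\circ(G\times\mathrm{id})$ be its reversible update at $i$. Consider the function $G\times G^{-1}$ from $\mathcal{C}_\Sigma^2$ to $\mathcal{C}_\Sigma^2$, where $\mathcal{C}_\Sigma=\Sigma^{\mathbb{Z}}$. Then $$G\times G^{-1}=S\circ\prod_{i}K_i,\qquad\text{with}\qquad \mathrm{Loc}(K_0)=\bigl(\{0\}\times\mathcal{BN}\bigr)\cup\{(1,0)\}.$$
   Context: A reversible cellular automaton (RCA) over a finite alphabet $\Sigma$ is a bijection $G$ of the configuration space $\mathcal{C}_\Sigma=\Sigma^{\mathbb{Z}}$ that commutes with all translations and is causal (there is a finite $\mathcal{N}\subset\mathbb{Z}$ such that $G(c)_0$ depends only on $c|_{\mathcal{N}}$), and whose inverse $G^{-1}$ has the same properties. Two-layer configurations: $\mathcal{C}_{\Sigma^2}\simeq\mathcal{C}_\Sigma\times\mathcal{C}_\Sigma\simeq\Sigma^{\{0,1\}\times\mathbb{Z}}$. A configuration is a pair $(c,e)$, where $c$ is the first component (subcells $(0,j)$, $j\in\mathbb{Z}$) and $e$ is the second component (subcells $(1,j)$). In particular, $(1,0)$ denotes the subcell of the second component at cell $0$. For each cell $i$, $S_i$ is the map on $\mathcal{C}_{\Sigma^2}$ that exchanges the contents of subcells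 $(0,i)$ and $(1,i)$ and leaves all other subcells unchanged. $S=\prod_i S_i$ is the global swap $(c,e)\mapsto(e,c)$. Localization: let $X$ be a set of (sub)cells and $f$ a bijection of $\Sigma^X$. For $Y\subseteq X$, $f$ is localized upon $Y$ if $f=f_Y\times\mathrm{id}_{X\setminus Y}$ for some bijection $f_Y$ of $\Sigma^Y$ (identifying $\Sigma^X=\Sigma^Y\times\Sigma^{X\setminus Y}$). $\mathrm{Loc}(f)$ denotes the smallest (for inclusion) $Y\subseteq X$ upon which $f$ is localized. Semilocalizability: a bijection $F:A\times B\to C\times D$ is semilocalizable (with respect to these decompositions) if there are a set $E$ and bijections $g:A\to C\times E$ and $\tilde h:E\times B\to D$ such that $F=(\mathrm{id}_C\times\tilde h)\circ(g\times\mathrm{id}_B)$. Block neighborhood: $\mathcal{BN}$ is the smallest subset of $\mathbb{Z}$ such that $G$, viewed as a bijection $\Sigma^{\mathcal{BN}}\times\Sigma^{\mathbb{Z}\setminus\mathcal{BN}}\to\Sigma^{\{0\}}\times\Sigma^{\mathbb{Z}\setminus\{0\}}$, is semilocalizable. It is known that this smallest set exists and is finite. Infinite product: the maps $K_i$ commute pairwise, each is localized upon a finite set of subcells, and for any given subcell only finitely many $K_i$ act on it. Hence $\prod_i K_i$ is well-defined as a circuit of finite depth: its value at a configuration $w$ and subcell $x$ is the common value of $\bigl(\prod_{i\in I}K_i\bigr)(w)_x$ for all sufficiently large finite index sets $I$. The product $\prod_i S_i$ is understood in the same way.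
   Formalization: The alphabet is assumed to have at least two letters: for a one-letter alphabet BN and Loc(K_0) are both empty, so the claimed formula for Loc(K_0), which contains (1,0), fails; for the empty alphabet no smallest block neighborhood exists. *)

(* Defs.v *)
From mathcomp Require Import all_boot all_order all_algebra.
From mathcomp Require Import boolp classical_sets functions.

Set Implicit Arguments.
Unset Strict Implicit.
Unset Printing Implicit Defensive.

Import GRing.Theory.

Local Open Scope ring_scope.
Local Open Scope classical_set_scope.

(* [T -> S] is the set S^T of configurations over a set of (sub)cells T;
   a [Y : set T] coerces to the type of its elements, so [Y -> S] is S^Y. *)

Section Decompositions.
Variables (T S : Type).
Implicit Types (Y : set T) (f : (T -> S) -> (T -> S)).

Definition split_conf Y (c : T -> S) : (Y -> S) * (~` Y -> S) :=
  (fun y => c (set_val y), fun y => c (set_val y)).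

Definition glue_conf Y (ab : (Y -> S) * (~` Y -> S)) : T -> S := fun x =>
  match pselect (Y x) with
  | left h => ab.1 (SigSub (mem_set h))
  | right h => ab.2 (SigSub (mem_set (h : (~` Y) x)))
  end.

Lemma split_confK Y : cancel (split_conf Y) (@glue_conf Y).
Proof. by move=> c; apply/funext => x; rewrite /glue_conf; case: pselect. Qed.

Lemma glue_confK Y : cancel (@glue_conf Y) (split_conf Y).
Proof.
move=> [a b]; congr pair; apply/funext => -[x hx]; rewrite /glue_conf /=.
  case: pselect => h; first by congr a; apply: val_inj.
  by case: h; exact: set_mem hx.
case: pselect => h; last by congr b; apply: val_inj.
by case: (set_mem hx).
Qed.

(* [f] viewed as a map from S^Y * S^(T \ Y) to S^Z * S^(T \ Z). *)
Definition viewed Y (Z : set T) f :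
    (Y -> S) * (~` Y -> S) -> (Z -> S) * (~` Z -> S) :=
  fun ab => split_conf Z (f (glue_conf ab)).
Arguments viewed : clear implicits.

Definition localized f Y : Prop :=
  exists2 fY : (Y -> S) -> (Y -> S), bijective fY &
    viewed Y Y f = fun ab => (fY ab.1, ab.2).

End Decompositions.
Arguments viewed {T S} Y Z f ab.

Definition is_least (T : Type) (P : set T -> Prop) (Y : set T) : Prop :=
  P Y /\ forall Z, P Z -> Y `<=` Z.

Definition is_Loc (T S : Type) (f : (T -> S) -> (T -> S)) : set T -> Prop :=
  is_least (localized f).

Definition semilocalizable (A B C D : Type) (F : A * B -> C * D) : Prop :=
  exists (E : Type) (g : A -> C * E) (h : E * B -> D),
    [/\ bijective g, bijective h &
      F = fun ab => ((g ab.1).1, h ((g ab.1).2, ab.2))].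

Section CellularAutomata.
Variable Sigma : finType.

Definition conf : Type := int -> Sigma.

Definition translate (k : int) (c : conf) : conf := fun j => c (j + k).

Definition translation_invariant (G : conf -> conf) : Prop :=
  forall k c, G (translate k c) = translate k (G c).

Definition causal (G : conf -> conf) : Prop :=
  exists N : seq int, forall c c' : conf,
    {in N, c =1 c'} -> G c 0 = G c' 0.

Definition RCA (G Ginv : conf -> conf) : Prop :=
  [/\ cancel G Ginv, cancel Ginv G,
      translation_invariant G /\ causal G &
      translation_invariant Ginv /\ causal Ginv].

Definition is_block_neighborhood (G : conf -> conf) : set int -> Prop :=
  is_least (fun Y => semilocalizable (viewed Y [set 0] G)).

(* Subcell (b, j) is on the first layer if b = false, on the second one
   if b = true. *)
Definition subcell : Type := (bool * int)%type.
Definition conf2 : Type := subcell -> Sigma.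

(* The product map F x F' under the identification of conf * conf with
   conf2. *)
Definition layer_prod (F F' : conf -> conf) : conf2 -> conf2 := fun w x =>
  (if x.1 then F' else F) (fun j => w (x.1, j)) x.2.

Definition cell_swap (i : int) : conf2 -> conf2 := fun w x =>
  w (if x.2 == i then ~~ x.1 else x.1, x.2).

Definition global_swap : conf2 -> conf2 := fun w x => w (~~ x.1, x.2).

Definition rev_update (G Ginv : conf -> conf) (i : int) : conf2 -> conf2 :=
  layer_prod Ginv id \o cell_swap i \o layer_prod G id.

(* [P] is the infinite product of the [K i].  A finite index set is a
   duplicate-free sequence [I], and [foldr K w I] is the image of [w] under
   the composite of the [K i], i in I.  Quantifying over all such sequences
   makes the value independent of the order of composition. *)
Definition is_infinite_product (K : int -> conf2 -> conf2)
    (P : conf2 -> conf2) : Prop :=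
  forall w x, exists I0 : seq int, forall I : seq int,
    uniq I -> {subset I0 <= I} -> foldr K w I x = P w x.

Lemma is_infinite_product_unique K P Q :
  is_infinite_product K P -> is_infinite_product K Q -> P = Q.
Proof.
move=> hP hQ; apply/funext => w; apply/funext => x.
have [I hI] := hP w x; have [J hJ] := hQ w x.
by rewrite -(hI (undup (I ++ J))) ?(hJ (undup (I ++ J))) ?undup_uniq // => i;
  rewrite mem_undup mem_cat => ->; rewrite ?orbT.
Qed.

Lemma global_swapE : is_infinite_product cell_swap global_swap.
Proof.
move=> w [b j]; exists [:: j] => I uI sI.
suff -> : foldr cell_swap w I (b, j) = w (if j \in I then ~~ b else b, j).
  by rewrite (sI j) // mem_head.
elim: I uI b {sI} => [|i I IH] //= /andP[iI uI] b.
rewrite /cell_swap /= IH // inE; case: eqP => [->|_] //=.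
by rewrite (negbTE iI).
Qed.

End CellularAutomata.

(* Main.v *)
(* Writing (c, e) for a two-layer configuration, K_i replaces c by
   Ginv (G c with e_i at cell i) and e_i by (G c)_i.  In a finite product of
   K_i's the inner G \o Ginv cancel, and causality of Ginv gives the limit.
   For the localization, both "K_0 is localized upon {0} * Y + (1, 0)" and
   "G is semilocalizable from Y to {0}" say the same thing: (G c)_0 depends
   only on c|Y, and overwriting (G c)_0 by s amounts to modifying c inside Y
   only, in a way that depends only on c|Y and s. *)
Require Import Defs.
From mathcomp Require Import all_boot all_order all_algebra.
From mathcomp Require Import boolp classical_sets functions.

Set Implicit Arguments.
Unset Strict Implicit.
Unset Printing Implicit Defensive.

Local Open Scope ring_scope.
Local Open Scope classical_set_scope.

(** * Localization and semilocalizability as pointwise conditions on configurations *)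

Lemma split_conf1P (T S : Type) (Y : set T) (c c' : T -> S) :
  (split_conf Y c).1 = (split_conf Y c').1 <-> forall x, Y x -> c x = c' x.
Proof.
split=> [e x Yx|e]; last by apply/funext => -[x /[dup] /set_mem Yx ?]; exact: e.
exact: (congr1 (fun k => k (SigSub (mem_set Yx))) e).
Qed.

Lemma split_conf2P (T S : Type) (Y : set T) (c c' : T -> S) :
  (split_conf Y c).2 = (split_conf Y c').2 <-> forall x, ~ Y x -> c x = c' x.
Proof. exact: (@split_conf1P T S (~` Y) c c'). Qed.

Lemma viewed_split (T S : Type) (Y Z : set T) (f : (T -> S) -> (T -> S)) c :
  viewed Y Z f (split_conf Y c) = split_conf Z (f c).
Proof. by rewrite /viewed split_confK. Qed.

(** For an involution, the induced map on [Y] is its own inverse, so its bijectivity comes for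
    free. *)
Lemma involutive_localizedP (T S : Type) (s : S) (Y : set T)
    (f : (T -> S) -> (T -> S)) : involutive f ->
  localized f Y <->
    (forall c c', (forall x, Y x -> c x = c' x) ->
       forall x, Y x -> f c x = f c' x) /\
    (forall c x, ~ Y x -> f c x = c x).
Proof.
move=> fK; split=> [[fY _ fE]|[f_in f_out]].
  have fcE c : split_conf Y (f c) = (fY (split_conf Y c).1, (split_conf Y c).2).
    by rewrite -(@viewed_split _ _ Y) fE.
  split=> [c c' /split_conf1P e|c].
    by apply/split_conf1P; rewrite !fcE e.
  by apply/split_conf2P; rewrite fcE.
(* The padding symbol [s] is arbitrary: by [f_in], values on [Y] do not depend on it. *)
pose ext (a : Y -> S) := glue_conf (a, fun=> s).
have extK a : (split_conf Y (ext a)).1 = a by rewrite glue_confK.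
pose fY a := (split_conf Y (f (ext a))).1.
have fcE c : (split_conf Y (f c)).1 = fY (split_conf Y c).1.
  by apply/split_conf1P/f_in/split_conf1P; rewrite extK.
exists fY.
  by exists fY => a; rewrite -[a in LHS]extK -!fcE fK extK.
apply/funext => ab; rewrite -[ab]glue_confK viewed_split.
rewrite [LHS]surjective_pairing fcE; congr pair.
by apply/split_conf2P; exact: f_out.
Qed.

(** This eliminates the unknown set [E]: an element of [E] amounts to a pattern on [Y] up to changes
    of the symbol that [f] produces at [t]. Such changes are made by overwriting that symbol and
    pulling back along [f']. *)
Lemma bij_semilocalizableP (T : eqType) (S : Type) (s0 : S) (t : T) (Y : set T)
    (f f' : (T -> S) -> (T -> S)) : cancel f f' -> cancel f' f ->
  semilocalizable (viewed Y [set t] f) <->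
  [/\ forall c c', (forall x, Y x -> c x = c' x) -> f c t = f c' t,
      forall s c c', (forall x, Y x -> c x = c' x) ->
        forall x, Y x -> f' [eta f c with t |-> s] x =
                         f' [eta f c' with t |-> s] x &
      forall s c x, ~ Y x -> f' [eta f c with t |-> s] x = c x].
Proof.
move=> fK f'K.
pose upd s c := f' [eta f c with t |-> s].
have f_upd s c : f (upd s c) = [eta f c with t |-> s] by exact: f'K.
have upd_upd s s' c : upd s (upd s' c) = upd s c.
  by rewrite {1}/upd f_upd; congr f'; apply/funext => x /=; case: eqP.
have upd_id c : upd (f c t) c = c.
  by rewrite -[RHS]fK; congr f'; apply/funext => x /=; case: eqP => // ->.
split=> [[E [g [h [bg bh fE]]]]|[f_in upd_in upd_out]].
  have fcE c : split_conf [set t] (f c) =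
      ((g (split_conf Y c).1).1, h ((g (split_conf Y c).1).2, (split_conf Y c).2)).
    by rewrite -(@viewed_split _ _ Y) fE.
  (* Overwriting at [t] does not affect the [D]-component of the image, so injectivity of [h] fixes
     both of its arguments. *)
  have updE s c : (g (split_conf Y (upd s c)).1).2 = (g (split_conf Y c).1).2 /\
      (split_conf Y (upd s c)).2 = (split_conf Y c).2.
    have: (split_conf [set t] (f (upd s c))).2 = (split_conf [set t] (f c)).2.
      by apply/split_conf2P => x /eqP; rewrite f_upd /= => /negbTE ->.
    by rewrite !fcE => /(bij_inj bh) [].
  split=> [c c' /split_conf1P e|s c c' /split_conf1P e|s c].
  - have : (split_conf [set t] (f c)).1 = (split_conf [set t] (f c')).1.
      by rewrite !fcE e.
    by move/split_conf1P; apply.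
  (* By injectivity of [g], it suffices to compare the [E]-components, equal by [updE], and the
     symbols at [t], both [s]. *)
  - apply/split_conf1P/(bij_inj bg).
    rewrite [LHS]surjective_pairing [RHS]surjective_pairing.
    rewrite !(updE _ _).1 e; congr pair.
    have e1 c1 : (g (split_conf Y c1).1).1 = (split_conf [set t] (f c1)).1.
      by rewrite fcE.
    rewrite !e1; apply/split_conf1P => x ->.
    by rewrite !f_upd /= eqxx.
  - by apply/split_conf2P; exact: (updE _ _).2.
pose ext (a : Y -> S) := glue_conf (a, fun=> s0).
have extK a : (split_conf Y (ext a)).1 = a by rewrite glue_confK.
have ext_in c : forall x, Y x -> ext (split_conf Y c).1 x = c x.
  by apply/split_conf1P; rewrite extK.
(* The auxiliary set E of a semilocalization: the a whose image has the
   reference symbol s0 at t, any a being recovered from its normalization in E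
   and from its actual symbol at t. *)
pose E := {a : Y -> S | f (ext a) t = s0}.
have E_inj (u v : E) : sval u = sval v -> u = v.
  by case: u v => [a p] [b q] /= e; exact: eq_exist.
have normE a : f (ext (split_conf Y (upd s0 (ext a))).1) t = s0.
  by rewrite (f_in _ _ (ext_in _)) f_upd /= eqxx.
pose norm a : E := exist _ _ (normE a).
pose g (a : Y -> S) : ([set t] -> S) * E :=
  ((split_conf [set t] (f (ext a))).1, norm a).
pose h (eb : E * (~` Y -> S)) : ~` [set t] -> S :=
  (split_conf [set t] (f (glue_conf (sval eb.1, eb.2)))).2.
have tt : [set t] t by [].
pose at_t (k : [set t] -> S) := k (SigSub (mem_set tt)).
have at_tE k : k = (split_conf [set t] (fun=> at_t k)).1.
  apply/funext => -[x xt] /=; rewrite /at_t; congr k; apply: val_inj => /=.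
  exact: (set_mem xt).
exists E, g, h; split.
(* The inverse of [g] writes the recorded symbol back at [t]: a later overwrite cancels an earlier
   one, and rewriting the symbol already present changes nothing. *)
- exists (fun ke => (split_conf Y (upd (at_t ke.1) (ext (sval ke.2)))).1).
    move=> a; rewrite /= -[RHS]extK; apply/split_conf1P => x Yx.
    rewrite /upd (upd_in _ _ _ (ext_in _)) // -/(upd _ _) upd_upd.
    by rewrite /at_t /= upd_id.
  move=> [k [a fa]] /=; congr pair.
    rewrite [RHS]at_tE; apply/split_conf1P => x ->.
    by rewrite (f_in _ _ (ext_in _)) f_upd /= eqxx.
  apply: E_inj; rewrite /= -[RHS]extK; apply/split_conf1P => x Yx.
  by rewrite /upd (upd_in _ _ _ (ext_in _)) // -/(upd _ _) upd_upd -fa upd_id.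
- have f_glue (e : E) b : f (glue_conf (sval e, b)) t = s0.
    apply: etrans (svalP e).
    by apply/f_in/split_conf1P; rewrite extK glue_confK.
  (* The inverse of [h] puts [s0] at [t], applies [f'] and splits along [Y]; the choice of [s0]
     makes the [Y]-part land in [E]. *)
  pose ext' (d : ~` [set t] -> S) := glue_conf ((fun=> s0), d) : T -> S.
  have ext'_t d : ext' d t = s0.
    by rewrite /ext' /glue_conf; case: pselect.
  have f_ext' d : f (ext (split_conf Y (f' (ext' d))).1) t = s0.
    by rewrite (f_in _ _ (ext_in _)) f'K.
  exists (fun d => (exist _ _ (f_ext' d) : E, (split_conf Y (f' (ext' d))).2)).
    move=> [e b].
    have fE : ext' (h (e, b)) = f (glue_conf (sval e, b)).
      rewrite -[RHS](split_confK [set t]) /ext'; congr glue_conf.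
      rewrite [RHS]surjective_pairing; congr pair.
      rewrite [LHS]at_tE; apply/split_conf1P => x ->.
      by rewrite f_glue.
    congr pair; last by rewrite fE fK glue_confK.
    by apply: E_inj; rewrite [LHS]/sval fE fK glue_confK.
  move=> d; transitivity (split_conf [set t]
    (f (glue_conf (split_conf Y (f' (ext' d)))))).2 => //.
  by rewrite split_confK f'K glue_confK.
apply/funext => -[a b].
have glue_in x : Y x -> glue_conf (a, b) x = ext a x.
  by move: x; apply/split_conf1P; rewrite extK glue_confK.
rewrite /viewed [LHS]surjective_pairing; congr pair.
  by apply/split_conf1P => x ->; exact: f_in.
rewrite /h /=.
(* Normalizing the [Y]-part alone is the same as overwriting in the whole configuration, since [upd]
   acts only inside [Y]. *)
have -> : glue_conf ((split_conf Y (upd s0 (ext a))).1, b) =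
    upd s0 (glue_conf (a, b)).
  rewrite -[RHS](split_confK Y) [split_conf Y (upd _ (glue_conf _))]surjective_pairing.
  congr (glue_conf (_, _)).
    by apply/split_conf1P/upd_in => x /glue_in.
  rewrite -[b in LHS](congr1 snd (glue_confK (a, b))).
  by apply/split_conf2P => x nY; rewrite /upd upd_out.
by apply/split_conf2P => x /eqP; rewrite f_upd /= => /negbTE ->.
Qed.

(** * Reversible updates and their infinite product *)

Section ReversibleUpdate.
Variables (Sigma : finType) (G Ginv : conf Sigma -> conf Sigma).
Hypotheses (GK : cancel G Ginv) (GinvK : cancel Ginv G).

Definition layer (b : bool) (w : conf2 Sigma) : conf Sigma := fun j => w (b, j).

Lemma rev_update_first i w j :
  rev_update G Ginv i w (false, j) =
  Ginv [eta G (layer false w) with i |-> w (true, i)] j.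
Proof.
rewrite /rev_update /layer_prod /cell_swap /=; congr (Ginv _ j).
by apply/funext => k /=; case: eqP => [->|].
Qed.

Lemma rev_update_second i w j :
  rev_update G Ginv i w (true, j) =
  if j == i then G (layer false w) j else w (true, j).
Proof. by rewrite /rev_update /layer_prod /cell_swap /=; case: eqP. Qed.

Lemma layer_prodK (F F' : conf Sigma -> conf Sigma) :
  cancel F F' -> cancel (layer_prod F id) (layer_prod F' id).
Proof.
move=> FK w; apply/funext => -[[] j] //; rewrite /layer_prod /=.
exact: (congr1 (fun c => c j) (FK (layer false w))).
Qed.

Lemma cell_swapK i : involutive (@cell_swap Sigma i).
Proof.
by move=> w; apply/funext => -[b j]; rewrite /cell_swap /=; case: eqP; rewrite ?negbK.
Qed.

(** The update is a conjugate of the involution [cell_swap i]. *)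
Lemma rev_updateK i : involutive (rev_update G Ginv i).
Proof.
move=> w; rewrite /rev_update /= (layer_prodK GinvK) cell_swapK.
exact: layer_prodK.
Qed.

Lemma foldr_rev_update I w :
  foldr (rev_update G Ginv) w I =
  layer_prod Ginv id (foldr (@cell_swap Sigma) (layer_prod G id w) I).
Proof.
elim: I => [|i I IH] /=; first by rewrite (layer_prodK GK).
by rewrite IH /rev_update /= (layer_prodK GinvK).
Qed.

Lemma causal_at (F : conf Sigma -> conf Sigma) j :
  translation_invariant F -> causal F ->
  exists N : seq int, forall c c', {in N, c =1 c'} -> F c j = F c' j.
Proof.
move=> F_inv [N FN]; exists [seq n + j | n <- N] => c c' cc'.
have F_at d : F d j = F (translate j d) 0.
  by rewrite F_inv /translate GRing.add0r.
rewrite !F_at; apply: FN => n nN; exact/cc'/map_f.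
Qed.

Lemma rev_update_product :
  translation_invariant Ginv -> causal Ginv ->
  is_infinite_product (rev_update G Ginv) (@global_swap Sigma \o layer_prod G Ginv).
Proof.
move=> Ginv_inv Ginv_causal w [b j].
have swapE := @global_swapE Sigma (layer_prod G id w).
have [N GinvN] := causal_at j Ginv_inv Ginv_causal.
case: b.
  have [I0 I0P] := swapE (true, j).
  by exists I0 => I uI sI; rewrite foldr_rev_update {1}/layer_prod /= I0P.
(* The first layer at [j] is computed by [Ginv] from all cells of [N], so [J] must ensure that every
   one of them has been swapped. *)
have [J JP] : exists J : seq int, forall I, uniq I -> {subset J <= I} ->
    {in N, forall k, foldr (@cell_swap Sigma) (layer_prod G id w) I (false, k) =
       w (true, k)}.
  elim: {GinvN} N => [|k N [J JP]]; first by exists [::].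
  have [I0 I0P] := swapE (false, k).
  exists (I0 ++ J) => I uI sI n; rewrite inE => /predU1P[->|nN].
    by rewrite I0P // => i iI; apply: sI; rewrite mem_cat iI.
  by rewrite JP // => i iJ; apply: sI; rewrite mem_cat iJ orbT.
exists J => I uI sI; rewrite foldr_rev_update /layer_prod /=.
by apply: GinvN => k kN; exact: JP.
Qed.

(** * The localization of the update at cell 0 *)

Lemma rev_update_localized (s : Sigma) (Y : set int) :
  semilocalizable (viewed Y [set 0] G) ->
  localized (rev_update G Ginv 0) ([set false] `*` Y `|` [set (true, 0)]).
Proof.
move/(bij_semilocalizableP s _ _ GK GinvK) => [G_in upd_in upd_out].
apply/(involutive_localizedP s _ (rev_updateK 0)); split.
  move=> w w' ww'.
  have ww'Y j : Y j -> layer false w j = layer false w' j.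
    by move=> Yj; apply: ww'; left.
  move=> [b j] [[/= -> Yj]|[-> ->]].
    by rewrite !rev_update_first (ww' (true, 0)); [exact: upd_in|right].
  by rewrite !rev_update_second eqxx; exact: G_in.
move=> w [[] j] nYj.
  by rewrite rev_update_second; case: eqP => // j0; case: nYj; right; rewrite j0.
by rewrite rev_update_first upd_out // => Yj; apply: nYj; left.
Qed.

(** If the update fixed the subcell [(true, 0)], then [G c 0] would equal whatever symbol is stored
    there, which is absurd with two symbols. *)
Lemma localized_rev_update_swapped (Z : set subcell) : (1 < #|Sigma|)%N ->
  localized (rev_update G Ginv 0) Z -> Z (true, 0).
Proof.
move=> /card_gt1P[s [s' [_ _ /eqP ss']]].
move=> /(involutive_localizedP s _ (rev_updateK 0)) [_ K_out].
apply: contrapT => nZ; apply: ss'.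
have K_at u : G (fun=> s) 0 = u.
  have := K_out (fun x => if x.1 then u else s) _ nZ.
  by rewrite rev_update_second eqxx.
by rewrite -(K_at s) -(K_at s').
Qed.

Lemma localized_rev_update_semilocalizable (s : Sigma) (Z : set subcell) :
  Z (true, 0) -> localized (rev_update G Ginv 0) Z ->
  semilocalizable (viewed [set j | Z (false, j)] [set 0] G).
Proof.
move=> Z10 /(involutive_localizedP s _ (rev_updateK 0)) [K_in K_out].
(* With a constant second layer [u], agreement on [Z] only concerns the first layer, whatever
   second-layer subcells [Z] contains; [u] is also the symbol swapped into cell 0. *)
pose w u (c : conf Sigma) : conf2 Sigma := fun x => if x.1 then u else c x.2.
have w_in u (c c' : conf Sigma) : (forall j, Z (false, j) -> c j = c' j) ->
    forall x, Z x -> w u c x = w u c' x.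
  by move=> cc' [[] j] //; exact: cc'.
apply/(bij_semilocalizableP s _ _ GK GinvK); split.
- move=> c c' cc'; have := K_in _ _ (w_in s c c' cc') _ Z10.
  by rewrite !rev_update_second eqxx.
- move=> u c c' cc' j Zj; have := K_in _ _ (w_in u c c' cc') _ Zj.
  by rewrite !rev_update_first.
- move=> u c j Zj; have := K_out (w u c) _ Zj.
  by rewrite rev_update_first.
Qed.

End ReversibleUpdate.

Theorem corollary1 (Sigma : finType) (hSigma : (1 < #|Sigma|)%N)
    (G Ginv : conf Sigma -> conf Sigma) (hG : RCA G Ginv)
    (BN : set int) (hBN : is_block_neighborhood G BN) :
  (exists2 P : conf2 Sigma -> conf2 Sigma,
      is_infinite_product (rev_update G Ginv) P &
      layer_prod G Ginv = @global_swap Sigma \o P) /\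
  is_Loc (rev_update G Ginv 0) ([set false] `*` BN `|` [set (true, 0)]).
Proof.
have [GK GinvK _ [Ginv_inv Ginv_causal]] := hG.
have [BN_semi BN_least] := hBN.
have [s _] := card_gt1P hSigma.
split.
  (* The global swap is an involution, which forces this witness. *)
  exists (@global_swap Sigma \o layer_prod G Ginv).
    exact: rev_update_product.
  by apply/funext => w; apply/funext => -[b j]; rewrite /global_swap /= negbK.
split; first exact: rev_update_localized.
move=> Z locZ; have Z10 := localized_rev_update_swapped GK GinvK hSigma locZ.
move=> [b j] [[/= -> BNj]|[-> ->]] //.
(* Minimality of [BN] is applied to the first-layer trace of [Z]. *)
exact: (BN_least _ (localized_rev_update_semilocalizable GK GinvK s Z10 locZ)).
Qed.
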